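(* The Signature-inverse Theorem (the assertion that meshes with the same signature are congruent) is not correct in the mesh plane $M^{\mathbb{G}}$. That is, for each $\mathbb{G}\in\{S\mathbb{E}(2),\mathbb{E}(2),S\mathbb{A}(2),\bar{\mathbb{A}}(2)\}$ there exist two ordinary meshes (convex in the affine cases) with the same number of points which have the same $k$-point signature (both computed by the same formula among those listed in the context; $k=2$ in the Euclidean cases, $k=3$ in the affine cases) but which are not $\mathbb{G}$-congruent.
   Context: Groups: $S\mathbb{E}(2)=SO(2)\ltimes\mathbb{R}^2$, $\mathbb{E}(2)=O(2)\ltimes\mathbb{R}^2$, $S\mathbb{A}(2)=SL(2)\ltimes\mathbb{R}^2$, and $\bar{\mathbb{A}}(2)$ is $S\mathbb{A}(2)$ extended by reflections. A mesh is a finite list of successive points $p_1,\dots,p_n\in\mathbb{R}^2$ (consecutive points distinct). It is ordinary if there is no $i$ with $p_{i+1}=p_{i-1}$, and convex if no three of its points are collinear. $M^{\mathbb{G}}$ is the space of planar ordinary meshes acted on by $\mathbb{G}$. Two $n$-point meshes are $\mathbb{G}$-congruent if there is $g\in\mathbb{G}$ with $\tilde p_i=g\cdot p_i$ for all $i$. Euclidean case: $\kappa(p_i)=\frac{4\Delta}{abc}(p_i)$, where $a\ge b\ge c$ are the side lengths and $\Delta$ the area of the triangle $p_{i-1},p_i,p_{i+1}$; $d_{i,j}=|p_i-p_j|$, $d_i=d_{i,i+1}$. The 2-point signature is the set, over all $p_i$ for which the quantities are defined, of pairs $(\kappa(p_i),\kappa'(p_i))$, where: for equally spaced meshes (all $d_i$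 equal) $\kappa'(p_i)=\frac{\kappa(p_{i+1})-\kappa(p_i)}{d_i}$ or, in centered form, $\kappa'(p_i)=\frac{\kappa(p_{i+1})-\kappa(p_{i-1})}{d_{i-1,i+1}}$; for unequally spaced meshes $\kappa'(p_i)=3\,\frac{\kappa(p_{i+1})-\kappa(p_i)}{d_{i-1,i+2}}$ or, in centered form, $\kappa'(p_i)=3\,\frac{\kappa(p_{i+1})-\kappa(p_{i-1})}{d_{i-3,i+3}}$. Affine case (convex meshes): let $Ax^2+2Bxy+Cy^2+2Dx+2Ey+G=0$ be the conic through $p_{i-2},\dots,p_{i+2}$, $S=AC-B^2$, $F=\det\begin{pmatrix} A & B & D \\ B & C & E \\ D & E & G \end{pmatrix}$, $\kappa(p_i)=\frac{S}{F^{2/3}}(p_i)$. The affine arc length from $p_k$ to $p_l$ (computed with the conic at $p_i$) is $L_{k,l}=|\kappa(p_i)\,[klO]|$ if $\kappa(p_i)\neq0$, where $O=\left(\frac{BE-CD}{AC-B^2},-\frac{AE-BD}{AC-B^2}\right)$ and $[klO]$ is the signed area of the parallelogram with sides $p_k-p_l$ and $p_k-O$; and $L_{k,l}=\sqrt[3]{\frac{A^2}{AE-BD}}\left[(x_k-x_l)+\frac{B}{A}(y_k-y_l)\right]$ if $\kappa(p_i)=0$, where $p_k=(x_k,y_k)$, $p_l=(x_l,y_l)$. Write $L_k=L_{k,k+1}$. The 3-point signature is the set of pairs $(\kappa(p_i),\kappa'(p_i))$ with: for equally spaced meshes $\kappa'(p_i)=\frac{\kappa(p_{i+1})-\kappa(p_i)}{L_i}$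 or $\frac{\kappa(p_{i+1})-\kappa(p_{i-1})}{L_{i-1,i+1}}$; for unequally spaced meshes $\kappa'(p_i)=5\,\frac{\kappa(p_{i+1})-\kappa(p_i)}{L_{i-2,i+3}}$ or $5\,\frac{\kappa(p_{i+1})-\kappa(p_{i-1})}{L_{i-5,i+5}}$. *)

(* Defs.v *)
From mathcomp Require Import all_boot all_order all_algebra.
From mathcomp Require Import classical_sets reals exp.

Set Implicit Arguments.
Unset Strict Implicit.
Unset Printing Implicit Defensive.

Import Order.TTheory GRing.Theory Num.Theory.
Local Open Scope classical_set_scope.
Local Open Scope ring_scope.

Inductive symmetry_group := SE2 | E2 | SA2 | A2bar.

Definition is_affine (G : symmetry_group) : bool :=
  match G with SE2 | E2 => false | SA2 | A2bar => true end.

Inductive spacing := EquallySpaced | UnequallySpaced.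

Inductive difference := Forward | Centered.

Section MeshGeometry.
Variable R : realType.
Implicit Types (P Q T : 'cV[R]_2) (M : 'M[R]_2) (p q : seq 'cV[R]_2).

(* Each group is the semidirect product of its linear part with the
   translations. Extending SL(2) by reflections gives the matrices of
   determinant 1 or -1. *)
Definition linear_part (G : symmetry_group) M : Prop :=
  match G with
  | SE2 => M *m M^T = 1%:M /\ \det M = 1
  | E2 => M *m M^T = 1%:M
  | SA2 => \det M = 1
  | A2bar => \det M = 1 \/ \det M = -1
  end.

Definition congruent (G : symmetry_group) p q : Prop :=
  size p = size q /\
  exists M (b : 'cV[R]_2), linear_part G M /\
    forall i, (i < size p)%N -> q`_i = M *m p`_i + b.

Definition xcoord P : R := P 0 0.
Definition ycoord P : R := P 1 0.
Definition vec2 (x y : R) : 'cV[R]_2 := \col_i (if i == 0 then x else y).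

(* The library norm on matrices is the sup norm, hence this definition. *)
Definition edist P Q : R :=
  Num.sqrt (xcoord (P - Q) ^+ 2 + ycoord (P - Q) ^+ 2).

Definition cross P Q : R := xcoord P * ycoord Q - ycoord P * xcoord Q.

Definition collinear P Q T : Prop := cross (Q - P) (T - P) = 0.

(* Meshes are indexed from 0: the points are p`_0, ..., p`_(size p).-1. *)
Definition is_mesh p : Prop :=
  forall i, (i.+1 < size p)%N -> p`_i <> p`_i.+1.

Definition ordinary_mesh p : Prop :=
  is_mesh p /\ forall i, (i.+2 < size p)%N -> p`_i.+2 <> p`_i.

Definition convex_mesh p : Prop :=
  forall i j k, (i < j)%N -> (j < k)%N -> (k < size p)%N ->
    ~ collinear p`_i p`_j p`_k.

Definition admissible (G : symmetry_group) p : Prop :=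
  ordinary_mesh p /\ (is_affine G -> convex_mesh p).

(* The curvatures and lengths are relations, as they need not be defined:
   [mesh_curvature G p i k] means that the curvature at p`_i is k, and
   [mesh_length G p i k l L] that the length from p`_k to p`_l, computed at
   p`_i, is L. *)

Definition triangle_area P Q T : R := `|cross (Q - P) (T - P)| / 2.

Definition euclidean_curvature p (i : nat) (k : R) : Prop :=
  let a := edist p`_i.-1 p`_i in
  let b := edist p`_i p`_i.+1 in
  let c := edist p`_i.-1 p`_i.+1 in
  [/\ (0 < i)%N, (i.+1 < size p)%N, a * b * c != 0 &
      k = 4 * triangle_area p`_i.-1 p`_i p`_i.+1 / (a * b * c)].

(* The Euclidean distance does not depend on the base point i. *)
Definition euclidean_length p (i k l : nat) (L : R) : Prop :=
  [/\ (k < size p)%N, (l < size p)%N & L = edist p`_k p`_l].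

(* A x^2 + 2 B x y + C y^2 + 2 D x + 2 E y + G = 0 *)
Record conic := Conic { cA : R; cB : R; cC : R; cD : R; cE : R; cG : R }.

Definition on_conic (c : conic) P : Prop :=
  let x := xcoord P in let y := ycoord P in
  cA c * x ^+ 2 + 2 * cB c * x * y + cC c * y ^+ 2
    + 2 * cD c * x + 2 * cE c * y + cG c = 0.

Definition conic_mx (c : conic) : 'M[R]_3 :=
  \matrix_(i, j) (nth [::] [:: [:: cA c; cB c; cD c];
                               [:: cB c; cC c; cE c];
                               [:: cD c; cE c; cG c]] i)`_j.

Definition conicS (c : conic) : R := cA c * cC c - cB c ^+ 2.
Definition conicF (c : conic) : R := \det (conic_mx c).

(* Real cube root, of the sign of its argument; F^(2/3) is its square. *)
Definition cbrt (x : R) : R := Num.sg x * `|x| `^ (3^-1).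

Definition conic_curvature (c : conic) : R := conicS c / cbrt (conicF c) ^+ 2.

Definition conic_center (c : conic) : 'cV[R]_2 :=
  vec2 ((cB c * cE c - cC c * cD c) / conicS c)
        (- ((cA c * cE c - cB c * cD c) / conicS c)).

Definition conic_length (c : conic) P Q : R :=
  if conic_curvature c != 0 then
    `|conic_curvature c * cross (P - Q) (P - conic_center c)|
  else
    cbrt (cA c ^+ 2 / (cA c * cE c - cB c * cD c))
      * ((xcoord P - xcoord Q) + cB c / cA c * (ycoord P - ycoord Q)).

Definition conic_length_defined (c : conic) : Prop :=
  conic_curvature c = 0 ->
  cA c != 0 /\ cA c * cE c - cB c * cD c != 0.

(* For a convex mesh the conic at p`_i is unique up to a nonzero factor, and
   conic_curvature and conic_length do not depend on that factor. *)
Definition conic_at p (i : nat) (c : conic) : Prop :=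
  [/\ (1 < i)%N, (i.+2 < size p)%N, c <> Conic 0 0 0 0 0 0 &
      forall j, (i - 2 <= j <= i + 2)%N -> on_conic c p`_j].

Definition affine_curvature p (i : nat) (k : R) : Prop :=
  exists c, [/\ conic_at p i c, conicF c != 0 & k = conic_curvature c].

Definition affine_length p (i k l : nat) (L : R) : Prop :=
  [/\ (k < size p)%N, (l < size p)%N &
    exists c, [/\ conic_at p i c, conicF c != 0, conic_length_defined c &
                  L = conic_length c p`_k p`_l]].

Definition mesh_curvature (G : symmetry_group) :=
  if is_affine G then affine_curvature else euclidean_curvature.

Definition mesh_length (G : symmetry_group) :=
  if is_affine G then affine_length else euclidean_length.

Definition equally_spaced (G : symmetry_group) p : Prop :=
  forall i j (Li Lj : R),
    mesh_length G p i i i.+1 Li -> mesh_length G p j j j.+1 Lj -> Li = Lj.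

Definition has_spacing (G : symmetry_group) (s : spacing) p : Prop :=
  match s with
  | EquallySpaced => equally_spaced G p
  | UnequallySpaced => ~ equally_spaced G p
  end.

(* The pairs (kappa_i, m (kappa_(i+1) - kappa_(i-e)) / L_(i-a,i+b)), over all
   i for which every quantity is defined. The curvature at i is only defined
   for i > 0, so i - e is not truncated when e <= 1. *)
Definition curvature_pairs (G : symmetry_group) p (m : R) (e a b : nat) :
    set (R * R) :=
  [set z | exists i (k k0 k1 L : R),
    [/\ mesh_curvature G p i k, mesh_curvature G p (i - e) k0 &
        mesh_curvature G p i.+1 k1] /\
    [/\ (a <= i)%N, mesh_length G p i (i - a) (i + b) L, L != 0 &
        z = (k, m * ((k1 - k0) / L))]].

(* The 2-point signature for SE2 and E2, the 3-point one for SA2 and A2bar. *)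
Definition signature (G : symmetry_group) (s : spacing) (f : difference) p :
    set (R * R) :=
  match s, f with
  | EquallySpaced, Forward => curvature_pairs G p 1 0 0 1
  | EquallySpaced, Centered => curvature_pairs G p 1 1 1 1
  | UnequallySpaced, Forward =>
      if is_affine G then curvature_pairs G p 5 0 2 3
      else curvature_pairs G p 3 0 1 2
  | UnequallySpaced, Centered =>
      if is_affine G then curvature_pairs G p 5 1 5 5
      else curvature_pairs G p 3 1 3 3
  end.

End MeshGeometry.

(* Main.v *)
Require Import Defs.
From mathcomp Require Import all_boot all_order all_algebra.
From mathcomp Require Import classical_sets reals exp.
From mathcomp Require Import ring lra.
Import Order.TTheory GRing.Theory Num.Theory.
Local Open Scope classical_set_scope.
Local Open Scope ring_scope.

(** A signature records curvatures and their derivatives, so along a curve of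
constant curvature it is a single point, whatever the spacing of the mesh: the
differences of curvature vanish before they are divided by a length.  The
curves of zero curvature are the straight lines in the Euclidean geometry and
the parabolas in the affine one, and both are graphs [y = c * x ^ 2], with
[c = 0] and [c = 1].  The points of such a graph whose abscissas are the first
six multiples of a step [h] form a mesh that is equally spaced for the geometry
at hand and has signature [{(0, 0)}] (forward differences, lemma
[signature_zero_curvature]).

The steps 1 and 2 therefore give meshes with the same signature.  They are not
congruent: on the line, an orthogonal map would double a length; on the
parabola, an affine map of determinant 1 or -1 would multiply an area by 8.

The only computation is in the affine case, where the curvature is read on any
conic through five points of the mesh.  Restricted to the parabola, the
equation of a conic is a polynomial of degree at most 4 in the abscissa, so
that five points of the parabola determine the conic up to a factor
([conic_parabola]), which cancels in the curvature and in the length. *)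

Section ZeroCurvature.
Set Implicit Arguments.
Unset Strict Implicit.
Unset Printing Implicit Defensive.

Variable R : realType.
Implicit Types (P Q : 'cV[R]_2) (M : 'M[R]_2) (p : seq 'cV[R]_2).
Implicit Types (c h x y : R) (C : conic R).

(** * Graphs of multiples of the square function *)

Lemma xcoord_vec2 x y : xcoord (vec2 x y) = x.
Proof. by rewrite /xcoord mxE. Qed.

Lemma ycoord_vec2 x y : ycoord (vec2 x y) = y.
Proof. by rewrite /ycoord mxE. Qed.

Lemma xcoordB P Q : xcoord (P - Q) = xcoord P - xcoord Q.
Proof. by rewrite /xcoord !mxE. Qed.

Lemma ycoordB P Q : ycoord (P - Q) = ycoord P - ycoord Q.
Proof. by rewrite /ycoord !mxE. Qed.

Definition coordE := (xcoordB, ycoordB, xcoord_vec2, ycoord_vec2).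

Definition graph_point c x := vec2 x (c * x ^+ 2).

Definition graph_mesh c h : seq 'cV[R]_2 :=
  mkseq (fun i => graph_point c (h * i%:R)) 6%N.

Lemma size_graph_mesh c h : size (graph_mesh c h) = 6%N.
Proof. by rewrite size_mkseq. Qed.

Lemma nth_graph_mesh c h i : (i < 6)%N ->
  (graph_mesh c h)`_i = graph_point c (h * i%:R).
Proof. exact: nth_mkseq. Qed.

(** This is the Vandermonde determinant of the three abscissas. *)
Lemma cross_graph c x1 x2 x3 :
  cross (graph_point c x2 - graph_point c x1)
        (graph_point c x3 - graph_point c x1)
  = c * (x2 - x1) * (x3 - x1) * (x3 - x2).
Proof. by rewrite /cross !coordE; ring. Qed.

Lemma graph_mesh_inj c h i j : h != 0 -> (i < 6)%N -> (j < 6)%N ->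
  (graph_mesh c h)`_i = (graph_mesh c h)`_j -> i = j.
Proof.
move=> h0 i6 j6; rewrite !nth_graph_mesh// => /(congr1 (@xcoord R)).
by rewrite !coordE => /(mulfI h0)/eqP; rewrite eqr_nat => /eqP.
Qed.

Lemma ordinary_graph_mesh c h : h != 0 -> ordinary_mesh (graph_mesh c h).
Proof.
move=> h0; split=> i; rewrite size_graph_mesh => i6.
  by move/(graph_mesh_inj h0 (ltnW i6) i6)/n_Sn.
by move/(graph_mesh_inj h0 i6 (ltnW (ltnW i6)))/eqP; rewrite gtn_eqF.
Qed.

Lemma convex_graph_mesh c h : c != 0 -> h != 0 -> convex_mesh (graph_mesh c h).
Proof.
move=> c0 h0 i j k ij jk; rewrite size_graph_mesh => k6.
have j6 := ltn_trans jk k6; have ik := ltn_trans ij jk.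
rewrite /collinear !nth_graph_mesh ?(ltn_trans ij j6)// cross_graph => /eqP.
rewrite !mulf_eq0 (negPf c0) -!mulrBr !mulf_eq0 (negPf h0) !subr_eq0 !eqr_nat.
by rewrite !gtn_eqF.
Qed.

(** * Signatures of zero-curvature meshes *)

(** Every index at which the forward difference is defined contributes the same
pair, whatever the lengths; the index [i] makes the signature nonempty. *)
Lemma signature_zero_curvature G p i L :
    (forall j k, mesh_curvature G p j k -> k = 0) ->
    mesh_curvature G p i 0 -> mesh_curvature G p i.+1 0 ->
    mesh_length G p i i i.+1 L -> L != 0 ->
  signature G EquallySpaced Forward p = [set (0, 0)].
Proof.
move=> curv0 ki ki1 Li L0; apply/seteqP; split=> z /=.
  move=> [j [k [k0 [k1 [L' [[/curv0-> /curv0-> /curv0->] [_ _ _ ->]]]]]]].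
  by rewrite subrr mul0r mulr0.
move=> ->; exists i, 0, 0, 0, L; rewrite !subn0 addn1.
by do 2?split=> //; rewrite subrr mul0r mulr0.
Qed.

(** * The straight line in Euclidean geometry *)

Lemma edist_line h x y :
  edist (graph_point 0 (h * x)) (graph_point 0 (h * y)) = `|h * (x - y)|.
Proof. by rewrite /edist !coordE !mul0r subr0 expr0n addr0 -mulrBr sqrtr_sqr. Qed.

Lemma line_curvature_eq0 h i k :
  euclidean_curvature (graph_mesh 0 h) i k -> k = 0.
Proof.
case; case: i => // i _; rewrite size_graph_mesh => i6 _ ->.
rewrite /triangle_area !succnK !nth_graph_mesh ?(ltnW i6) ?(ltnW (ltnW i6))//.
by rewrite cross_graph !mul0r normr0 mul0r mulr0 mul0r.
Qed.

Lemma line_curvature h i : h != 0 -> (0 < i)%N -> (i < 5)%N ->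
  euclidean_curvature (graph_mesh 0 h) i 0.
Proof.
case: i => // i h0 _ i5; have i4 := ltnW i5; have i3 := ltnW i4.
split; rewrite ?size_graph_mesh// !succnK !nth_graph_mesh//.
  rewrite !edist_line !mulf_neq0 // normr_eq0 mulf_neq0// subr_eq0 eqr_nat;
  by rewrite ltn_eqF.
by rewrite /triangle_area cross_graph !mul0r normr0 mul0r mulr0 mul0r.
Qed.

Lemma line_length h i L : (i.+1 < 6)%N ->
  euclidean_length (graph_mesh 0 h) i i i.+1 L <-> L = `|h|.
Proof.
move=> i6; rewrite /euclidean_length size_graph_mesh i6 (ltnW i6).
rewrite !nth_graph_mesh ?(ltnW i6)// edist_line -natr1.
rewrite opprD addrA subrr sub0r mulrN1 normrN.
by split=> [[]|].
Qed.

(** * The parabola in affine geometry *)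

(** On the parabola the equation of [C] is a polynomial of degree at most 4 in
the abscissa, whose coefficients are, up to nonzero factors, [cG C], [cD C],
[cA C + 2 * cE C], [cB C] and [cC C]; five roots make all of them vanish. *)
Lemma conic_parabola C (s : seq R) : uniq s -> size s = 5%N ->
    (forall x, x \in s -> on_conic C (graph_point 1 x)) ->
  C = Conic (cA C) 0 0 0 (- cA C / 2) 0.
Proof.
case: C => A B D' D E G us s5 onC /=.
pose P : {poly R} := Poly [:: G; 2 * D; A + 2 * E; 2 * B; D'].
have P0 : P = 0.
  apply: (@roots_geq_poly_eq0 _ _ s) => //; last by rewrite s5 size_Poly.
  apply/allP => x /onC; rewrite /on_conic /= !coordE /root horner_Poly /= => e.
  by apply/eqP; rewrite -[RHS]e; ring.
have coef i : [:: G; 2 * D; A + 2 * E; 2 * B; D']`_i = 0.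
  by rewrite -coef_Poly -/P P0 coef0.
have /= := (coef 0, coef 1, coef 2, coef 3, coef 4)%N.
move=> [[[[G0 D0] E0] B0] D'0].
by congr Conic; lra.
Qed.

Lemma det_mx22 M : \det M = M 0 0 * M 1 1 - M 0 1 * M 1 0.
Proof.
rewrite (expand_det_row _ 0) !big_ord_recl big_ord0 /cofactor !det_mx11 !mxE /=.
rewrite expr0 expr1 mul1r mulN1r mulrN addr0.
by congr (_ * M _ _ - M _ _ * M _ _); apply/val_inj.
Qed.

Lemma conicF_parabola x : conicF (Conic x 0 0 0 (- x / 2) 0) = - (x ^+ 3 / 4).
Proof.
rewrite /conicF (expand_det_row _ 0) !big_ord_recl big_ord0 /cofactor.
by rewrite !det_mx22 !mxE /=; field.
Qed.

Lemma conic_curvature_parabola x :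
  conic_curvature (Conic x 0 0 0 (- x / 2) 0) = 0.
Proof. by rewrite /conic_curvature /conicS /= mulr0 expr0n subr0 mul0r. Qed.

Lemma conic_length_parabola x P Q : x != 0 ->
  conic_length (Conic x 0 0 0 (- x / 2) 0) P Q
  = cbrt (- 2) * (xcoord P - xcoord Q).
Proof.
move=> x0; rewrite /conic_length conic_curvature_parabola eqxx /=.
rewrite !mul0r addr0 subr0; congr (cbrt _ * _); field.
by rewrite x0.
Qed.

Lemma conic_at_parabola h i C : h != 0 -> conic_at (graph_mesh 1 h) i C ->
  C = Conic (cA C) 0 0 0 (- cA C / 2) 0.
Proof.
move=> h0 [i1]; rewrite size_graph_mesh => i6 _ onC.
apply: (@conic_parabola _ [seq h * j%:R | j <- iota (i - 2) 5]).
- rewrite map_inj_uniq ?iota_uniq// => j k /(mulfI h0)/eqP.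
  by rewrite eqr_nat => /eqP.
- by rewrite size_map size_iota.
move=> x /mapP[j]; rewrite mem_iota => /andP[ij ji] ->.
have {}ji : (j <= i + 2)%N.
  by rewrite -ltnS (leq_trans ji)// -addnS -{2}(subnK i1) -addnA.
rewrite -nth_graph_mesh; first by apply: onC; rewrite ij.
by rewrite (leq_ltn_trans ji)// addn2.
Qed.

Lemma parabola_conic_at h i : (1 < i)%N -> (i < 4)%N ->
  conic_at (graph_mesh 1 h) i (Conic 1 0 0 0 (- 1 / 2) 0).
Proof.
move=> i1 i4; split; rewrite ?size_graph_mesh//.
  by case=> /eqP; rewrite oner_eq0.
move=> j /andP[_ ji]; rewrite nth_graph_mesh; last first.
  by rewrite (leq_ltn_trans ji)// addn2.
by rewrite /on_conic /= !coordE; field.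
Qed.

Lemma parabola_curvature_eq0 h i k : h != 0 ->
  affine_curvature (graph_mesh 1 h) i k -> k = 0.
Proof.
move=> h0 [C [/(conic_at_parabola h0) -> _ ->]].
exact: conic_curvature_parabola.
Qed.

Lemma conicF_unit_parabola_neq0 :
  conicF (Conic 1 0 0 0 (- 1 / 2) 0 : conic R) != 0.
Proof.
by rewrite conicF_parabola oppr_eq0 mulf_neq0 ?invr_eq0 ?pnatr_eq0// expr1n oner_eq0.
Qed.

Lemma parabola_curvature h i : (1 < i)%N -> (i < 4)%N ->
  affine_curvature (graph_mesh 1 h) i 0.
Proof.
move=> i1 i4; exists (Conic 1 0 0 0 (- 1 / 2) 0).
by rewrite conic_curvature_parabola conicF_unit_parabola_neq0;
  split=> //; exact: parabola_conic_at.
Qed.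

(** On a multiple of the conic [x ^ 2 - y = 0], the affine length is the
difference of the abscissas up to a constant, hence the equal spacing. *)
Lemma parabola_length_eq h i L : h != 0 ->
  affine_length (graph_mesh 1 h) i i i.+1 L -> L = cbrt (- 2) * - h.
Proof.
move=> h0 [_]; rewrite size_graph_mesh => i6 [C [/(conic_at_parabola h0) ->]].
rewrite conicF_parabola oppr_eq0 => F0 _ ->.
rewrite conic_length_parabola; last first.
  by apply: contra_neq F0 => ->; rewrite expr0n mul0r.
rewrite !nth_graph_mesh ?(ltnW i6)// !coordE -natr1; congr (_ * _); ring.
Qed.

Lemma parabola_length h i : (1 < i)%N -> (i < 4)%N ->
  affine_length (graph_mesh 1 h) i i i.+1 (cbrt (- 2) * - h).
Proof.
move=> i1 i4; have i6 : (i.+1 < 6)%N := leqW i4.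
split; rewrite ?size_graph_mesh ?(ltnW i6)//.
exists (Conic 1 0 0 0 (- 1 / 2) 0); split.
- exact: parabola_conic_at.
- exact: conicF_unit_parabola_neq0.
- move=> _ /=; rewrite oner_eq0; split=> //.
  by rewrite mul0r subr0 mul1r mulf_neq0// ?oppr_eq0 ?oner_eq0// invr_eq0 pnatr_eq0.
rewrite conic_length_parabola ?oner_eq0// !nth_graph_mesh ?(ltnW i6)//.
rewrite !coordE -natr1; congr (_ * _); ring.
Qed.

Lemma cbrt_neq0 x : x != 0 -> cbrt x != 0.
Proof.
move=> x0; rewrite /cbrt mulf_neq0 ?sgr_eq0//.
by rewrite gt_eqF// powR_gt0 ?normr_gt0.
Qed.

(** * The meshes of steps 1 and 2 *)

Definition zero_curvature_mesh (G : symmetry_group) h :=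
  graph_mesh (if is_affine G then 1 else 0) h.

Lemma admissible_zero_curvature_mesh G h : h != 0 ->
  admissible G (zero_curvature_mesh G h).
Proof.
move=> h0; split; first exact: ordinary_graph_mesh.
rewrite /zero_curvature_mesh => ->.
by apply: convex_graph_mesh; rewrite ?oner_eq0.
Qed.

Lemma equally_spaced_zero_curvature_mesh G h : h != 0 ->
  equally_spaced G (zero_curvature_mesh G h).
Proof.
move=> h0 i j Li Lj; rewrite /mesh_length /zero_curvature_mesh.
case: is_affine; first by do 2!move=> /(parabola_length_eq h0)->.
move=> pi pj; have [_ i6 _] := pi; have [_ j6 _] := pj.
rewrite size_graph_mesh in i6 j6.
by move: pi pj => /(line_length _ _ i6)-> /(line_length _ _ j6)->.
Qed.

Lemma signature_zero_curvature_mesh G h : h != 0 ->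
  signature G EquallySpaced Forward (zero_curvature_mesh G h) = [set (0, 0)].
Proof.
move=> h0.
(* At index 2 the forward difference is defined in both geometries. *)
pose L := if is_affine G then cbrt (- 2) * - h else `|h|.
apply: (@signature_zero_curvature _ _ 2 L);
  rewrite /mesh_curvature /mesh_length /zero_curvature_mesh /L;
  case: is_affine => //.
- by move=> j k; apply: parabola_curvature_eq0.
- by move=> j k; apply: line_curvature_eq0.
- exact: parabola_curvature.
- exact: line_curvature.
- exact: parabola_curvature.
- exact: line_curvature.
- exact: parabola_length.
- exact/line_length.
- by rewrite mulf_neq0 ?oppr_eq0// cbrt_neq0// oppr_eq0 pnatr_eq0.
- by rewrite normr_eq0.
Qed.

Lemma xcoord_mulmx M P : xcoord (M *m P) = M 0 0 * xcoord P + M 0 1 * ycoord P.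
Proof.
rewrite /xcoord /ycoord !mxE !big_ord_recl big_ord0 addr0.
by rewrite (_ : lift ord0 ord0 = 1 :> 'I_2) //; apply/val_inj.
Qed.

Lemma ycoord_mulmx M P : ycoord (M *m P) = M 1 0 * xcoord P + M 1 1 * ycoord P.
Proof.
rewrite /xcoord /ycoord !mxE !big_ord_recl big_ord0 addr0.
by rewrite (_ : lift ord0 ord0 = 1 :> 'I_2) //; apply/val_inj.
Qed.

Lemma cross_mulmx M P Q : cross (M *m P) (M *m Q) = \det M * cross P Q.
Proof. by rewrite /cross !xcoord_mulmx !ycoord_mulmx det_mx22; ring. Qed.

Lemma orthogonal_sqr M P : M *m M^T = 1%:M ->
  xcoord (M *m P) ^+ 2 + ycoord (M *m P) ^+ 2 = xcoord P ^+ 2 + ycoord P ^+ 2.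
Proof.
have sqrE (Q : 'cV[R]_2) : xcoord Q ^+ 2 + ycoord Q ^+ 2 = (Q^T *m Q) 0 0.
  rewrite /xcoord /ycoord !mxE !big_ord_recl big_ord0 addr0 !mxE !expr2.
  by congr (_ + Q _ _ * Q _ _); apply/val_inj.
move=> /mulmx1C MM; rewrite !sqrE trmx_mul -mulmxA [M^T *m _]mulmxA MM.
by rewrite mul1mx.
Qed.

Lemma zero_curvature_mesh_not_congruent G :
  ~ congruent G (zero_curvature_mesh G 1) (zero_curvature_mesh G 2).
Proof.
move=> [_ [M [b [GM]]]]; rewrite /zero_curvature_mesh size_graph_mesh => Mp.
set c := if _ then _ else _ in Mp.
(* Differences of points get rid of the translation. *)
have imB i : (i < 6)%N -> graph_point c (2 * i%:R) - graph_point c (2 * 0)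
    = M *m (graph_point c (1 * i%:R) - graph_point c (1 * 0)).
  move=> i6; have := Mp i i6; have := Mp 0%N isT.
  rewrite !nth_graph_mesh// => -> ->.
  by rewrite mulmxBr opprD addrACA subrr addr0.
(* The triangle on the first three points: areas scale by the determinant. *)
have det8 : c = 1 -> \det M = 8.
  move=> c1; have := cross_mulmx M (graph_point c (1 * 1) - graph_point c (1 * 0))
                                   (graph_point c (1 * 2) - graph_point c (1 * 0)).
  rewrite -(imB 1%N)// -(imB 2%N)// !cross_graph c1; lra.
(* The first side has length 1 in one mesh and 2 in the other. *)
have length2 : c = 0 -> M *m M^T != 1%:M.
  move=> c0; apply/eqP => /orthogonal_sqr.
  move=> /(_ (graph_point c (1 * 1) - graph_point c (1 * 0))).
  rewrite -(imB 1%N)// !coordE c0; lra.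
move: GM @c imB det8 length2 {Mp}; case: G => /=.
- by move=> [MM _] _ _ /(_ erefl)/eqP.
- by move=> MM _ _ /(_ erefl)/eqP.
- by move=> dM _ /(_ erefl); lra.
- by case=> dM _ /(_ erefl); lra.
Qed.

End ZeroCurvature.

Theorem proposition3p2 (R : realType) (G : symmetry_group) :
  exists (s : spacing) (f : difference) (p q : seq 'cV[R]_2),
    size p = size q /\
    admissible G p /\ admissible G q /\
    has_spacing G s p /\ has_spacing G s q /\
    signature G s f p = signature G s f q /\
    signature G s f p !=set0 /\
    ~ congruent G p q.
Proof.
have one0 : 1 != 0 :> R := oner_neq0 R.
have two0 : 2 != 0 :> R by rewrite pnatr_eq0.
exists EquallySpaced, Forward, (zero_curvature_mesh G 1), (zero_curvature_mesh G 2).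
rewrite !signature_zero_curvature_mesh// !size_graph_mesh.
split=> //; split; first exact: admissible_zero_curvature_mesh.
split; first exact: admissible_zero_curvature_mesh.
split; first exact: equally_spaced_zero_curvature_mesh.
split; first exact: equally_spaced_zero_curvature_mesh.
split=> //; split; first by exists (0, 0).
exact: zero_curvature_mesh_not_congruent.
Qed.
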